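(* Let $n\ge1$, $1\le i\le n$ be integers, $\alpha,\beta>0$, $\tau\ge0$ with $i\beta(\tau+1)>\tau$. Put $a=\frac{(n-i+1)\tau\beta+(n-i+1)\beta+\tau}{\beta}$ and, for $k\in\{0,1,2\}$, $b_k=\frac{i\tau\beta+(i+k)\beta-\tau}{\beta}$, and let $P=\left(\frac{\beta}{\alpha}\right)^{\tau}\frac{c(i,n)^{\tau+1}}{\beta^2}$. Then $$J^{(i)}_\tau(\beta)=C_1+C_2+C_3+C_4-C_5-C_6,$$ where $C_1=P\,B(a,b_0)$, $C_2=P\,i^2B(a,b_0)\left[\Psi'(b_0)+\Psi'(a)+(\Psi(b_0)-\Psi(a))^2\right]$, $C_3=P\,(n+1)^2B(a,b_2)\left[\Psi'(b_2)+\Psi'(a)+(\Psi(b_2)-\Psi(a))^2\right]$, $C_4=P\,2i\,B(a,b_0)\left[\Psi(b_0)-\Psi(a)\right]$, $C_5=P\,2(n+1)B(a,b_1)\left[\Psi(b_1)-\Psi(a)\right]$, $C_6=P\,2i(n+1)B(a,b_1)\left[\Psi'(b_1)+\Psi'(a)+(\Psi(b_1)-\Psi(a))^2\right]$.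
   Context: $c(i,n)=\frac{n!}{(n-i)!(i-1)!}$ and $f^{(i)}_{\alpha,\beta}(x)=\frac{c(i,n)\beta (x/\alpha)^{i\beta-1}}{\alpha(1+(x/\alpha)^\beta)^{n+1}}$, $x>0$, is the density of the $i$-th order statistic of a sample of size $n$ from the log-logistic distribution with scale $\alpha$ and shape $\beta$. With $\alpha$ regarded as known, $J^{(i)}_\tau(\beta)=\int_0^\infty\left(\frac{\partial}{\partial\beta}\log f^{(i)}_{\alpha,\beta}(x)\right)^2 f^{(i)}_{\alpha,\beta}(x)^{\tau+1}dx$. $B$ is the Beta function, $\Psi$ the digamma function and $\Psi'$ its derivative (trigamma function). *)

(* Defs.v *)
From HB Require Import structures.
From mathcomp Require Import all_boot all_order all_algebra.
From mathcomp Require Import all_classical all_reals all_analysis.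
Set Implicit Arguments. Unset Strict Implicit. Unset Printing Implicit Defensive.
Import Order.TTheory GRing.Theory Num.Theory.
Import numFieldNormedType.Exports.
Local Open Scope classical_set_scope.
Local Open Scope ring_scope.

Section Defs.
Variable R : realType.

Definition Gamma (x : R) : R :=
  Rintegral lebesgue_measure `]0, +oo[ (fun t : R => powR t (x - 1) * expR (- t)).

Definition digamma (x : R) : R := derive1 (fun y : R => ln (Gamma y)) x.
Definition trigamma (x : R) : R := derive1 digamma x.

Definition Beta (a b : R) : R :=
  Rintegral lebesgue_measure `]0, 1[ (fun t : R => powR t (a - 1) * powR (1 - t) (b - 1)).

Definition cc (i n : nat) : R := (n`!)%:R / (((n - i)`!)%:R * ((i - 1)`!)%:R).

(* density of the i-th order statistic of a log-logistic(alpha, beta) sample of size n *)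
Definition fos (n i : nat) (alpha beta x : R) : R :=
  cc i n * beta * powR (x / alpha) (i%:R * beta - 1)
  / (alpha * (1 + powR (x / alpha) beta) ^+ n.+1).

Definition Jtau (n i : nat) (alpha tau beta : R) : \bar R :=
  (\int[lebesgue_measure]_(x in (`]0%R, +oo[ : set R))
     ((derive1 (fun b : R => ln (fos n i alpha b x)) beta) ^+ 2
       * powR (fos n i alpha beta x) (tau + 1))%:E)%E.

End Defs.

(* Main.v *)
(* Put x = alpha * exp (z / beta).  The score of the order statistic becomes
   (1 + (i - (n + 1) v) z) / beta with v = e^z / (1 + e^z), and f^(tau+1) dx
   becomes a constant times e^(b_0 z) (1 + e^z)^(-(a + b_0)) dz.  Since a factor
   v^k turns b_0 into b_k in the latter, expanding the square leaves the moments
     int z^j e^(s z) (1 + e^z)^(-c) dz   with j <= 2, s = b_k, c = a + b_k.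
   These are the derivatives in s of the two-sided Laplace transform
     int e^(s z) (1 + e^z)^(-c) dz = Gamma s * Gamma (c - s) / Gamma c,
   and Gamma, too, is a Laplace transform: Gamma s = int e^(s z) e^(-e^z) dz.
   Differentiating under the integral sign on both sides expresses the moments
   through digamma and trigamma. *)
Require Import Defs.
From HB Require Import structures.
From mathcomp Require Import all_boot all_order all_algebra.
From mathcomp Require Import all_classical all_reals all_analysis.
From mathcomp Require Import measurable_realfun ring lra.
Set Implicit Arguments. Unset Strict Implicit. Unset Printing Implicit Defensive.
Import Order.TTheory GRing.Theory Num.Theory.
Import numFieldNormedType.Exports.
Local Open Scope classical_set_scope.
Local Open Scope ring_scope.

Local Notation mu := lebesgue_measure.

(** * Substitution for integrals over the line *)

Lemma nondecreasing_symitv (R : realType) :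
  nondecreasing_seq (fun n : nat => `[- (n%:R : R), n%:R]%classic).
Proof.
move=> m n mn; rewrite subsetEset; apply: subset_itv; rewrite bnd_simp ?lerN2 ler_nat//.
Qed.

Lemma bigcup_symitv (R : realType) :
  \bigcup_(n : nat) `[- (n%:R : R), n%:R]%classic = setT.
Proof.
apply/seteqP; split => // x _; exists (Num.truncn `|x|).+1 => //=.
rewrite in_itv/= -ler_norml ltW// truncnS_gt//.
Qed.

(** The rule holds on each segment [-n, n], and monotone convergence carries it to the line, so both
    sides may be infinite. Continuity of [G] is asked only on the range of [F]: real powers and [ln]
    will be continuous on the positive half-line only. *)
Lemma ge0_integral_subst (R : realType) (F f G : R -> R) :
  {homo F : x y / x < y} ->
  (forall x : R, is_derive x 1 F (f x)) -> continuous f ->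
  (forall x, {for F x, continuous G}) -> (forall x, 0 <= G (F x)) ->
  (\int[mu]_(x in range F) (G x)%:E =
   \int[mu]_x (G (F x) * f x)%:E)%E.
Proof.
move=> Fincr dF cf cG G0.
have cF : continuous F.
  by move=> x; apply: differentiable_continuous; apply/derivable1_diffP; exact: ex_derive.
have f0 x : 0 <= f x.
  have <- : derive1 F x = f x by rewrite derive1E derive_val.
  apply: (@incr_derive1_ge0 _ _ setT) => //.
  by move=> ? ? _ _; exact: Fincr.
  by rewrite interiorT.
have df : derive1 F = f by apply/funext => x; rewrite derive1E derive_val.
have Fle : {homo F : x y / x <= y}.
  by move=> x y; rewrite le_eqVlt => /predU1P[->//|/Fincr/ltW].
pose I n : set R := `[- (n%:R : R), n%:R]%classic.
pose J n : set R := `[F (- n%:R), F n%:R]%classic.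
have ndI := @nondecreasing_symitv R.
have ndJ : nondecreasing_seq J.
  move=> m n mn; rewrite subsetEset; apply: subset_itv; rewrite bnd_simp Fle// ?lerN2 ler_nat//.
(* By the intermediate value theorem [J n] lies in the range of [F], where [G] is known to be
   continuous and nonnegative. *)
have JI n y : J n y -> exists x, y = F x.
  rewrite /J/= in_itv/= => Jy.
  have le1 : - (n%:R : R) <= n%:R by rewrite (@le_trans _ _ 0)// oppr_le0.
  have [|z _ <-] := @IVT _ F _ _ y le1 (continuous_subspaceT cF); last by exists z.
  by have := Fle _ _ le1 => /[dup] /min_idPl -> /max_idPr ->.
have UJ : \bigcup_n J n = range F.
  apply/seteqP; split => [y [n _ /JI[x ->]]|y [x _ <-]]; first by exists x.
  have : setT x by [].
  rewrite -bigcup_symitv => -[n _ /=].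
  rewrite in_itv/= => /andP[x1 x2]; exists n => //; rewrite /J/= in_itv/= !Fle//.
rewrite -UJ -[in RHS]bigcup_symitv.
(* Both integrals are limits of this one sequence, read once over [J n] and once, after
   substitution, over [I n]. *)
apply: (@cvg_unique _ _ (\int[mu]_(x in J n) (G x)%:E @[n --> \oo])%E).
- exact: ereal_hausdorff.
- apply: ge0_nondecreasing_set_cvg_integral => //.
  + by move=> i; exact: measurable_itv.
  + move=> i; apply/measurable_EFinP.
    apply: subspace_continuous_measurable_fun; first exact: measurable_itv.
    by apply: continuous_in_subspaceT => y /set_mem/JI[x ->]; exact: cG.
  + by move=> i y /JI[x ->]; rewrite lee_fin.
- rewrite (_ : (fun n => _) = (fun n => \int[mu]_(x in I n) (G (F x) * f x)%:E)%E).
    apply: ge0_nondecreasing_set_cvg_integral => //.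
    + by move=> i; exact: measurable_itv.
    + move=> i; apply/measurable_EFinP; apply: measurable_funTS.
      apply: continuous_measurable_fun => x.
      by apply: cvgM; [exact: (continuous_comp (cF x) (cG x))|exact: cf].
    + by move=> i x _; rewrite lee_fin mulr_ge0.
  apply/funext => n; rewrite integration_by_substitution_increasing ?df//.
  + by rewrite (@le_trans _ _ 0)// oppr_le0.
  + by move=> x y _ _; exact: Fincr.
  + by apply/cvg_ex; exists (f (- n%:R)); apply: cvg_at_right_filter; exact: cf.
  + by apply/cvg_ex; exists (f n%:R); apply: cvg_at_left_filter; exact: cf.
  + split; first by move=> x _; exact: ex_derive.
      by apply: cvg_at_right_filter; exact: cF.
    by apply: cvg_at_left_filter; exact: cF.
  + by apply: continuous_in_subspaceT => y /set_mem/JI[x ->]; exact: cG.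
Qed.

(** * Two-sided Laplace transforms *)

Lemma expR_ge_exprn_fact (R : realType) (x : R) k : 0 <= x -> x ^+ k / k`!%:R <= expR x.
Proof.
case: k => [|k] x0; first by rewrite expr0 fact0 divr1; have := expR_ge1Dx x; lra.
by apply: le_trans (expR_ge1Dxn k x0); rewrite lerDr.
Qed.

Lemma expR_norm_le (R : realType) (x : R) : expR `|x| <= expR x + expR (- x).
Proof. by case: ger0P => _; rewrite ?lerDl ?lerDr expR_ge0. Qed.

(* The k-th derivative in [s] of the integrand of the two-sided Laplace
   transform of the weight [w]. *)
Definition laplace_mom (R : realType) (w : R -> R) (k : nat) (s z : R) : R :=
  z ^+ k * expR (s * z) * w z.

(** Half the distance to the nearer end serves. The margin leaves room to compare a moment at [s]
    with transforms at [s - e] and [s + e]. *)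
Lemma itv_margin (R : realType) (p s q : R) : p < s -> s < q ->
  exists2 e, 0 < e & p < s - e /\ s + e < q.
Proof.
move=> ps sq; exists (Num.min (s - p) (q - s) / 2).
  by rewrite divr_gt0// lt_min; lra.
have : Num.min (s - p) (q - s) <= s - p by rewrite ge_min lexx.
have : Num.min (s - p) (q - s) <= q - s by rewrite ge_min lexx orbT.
by split; lra.
Qed.

Lemma measurable_laplace_mom (R : realType) (w : R -> R) k s :
  measurable_fun setT w -> measurable_fun setT (laplace_mom w k s).
Proof.
move=> mw; apply: measurable_funM => //; apply: measurable_funM.
  exact: exprn_measurable.
by apply: measurableT_comp => //; apply: measurable_funM.
Qed.

(** One term of the exponential series gives |z|^k <= (k!/e^k) exp(e|z|) <= (k!/e^k) (exp(ez) +
    exp(-ez)), so the moment is dominated by the transforms at [s - e] and [s + e]. *)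
Lemma integrable_laplace_mom (R : realType) (w : R -> R) (p q : R) k s :
  (forall z, 0 <= w z) -> measurable_fun setT w ->
  (forall s, p < s < q -> mu.-integrable setT (EFin \o laplace_mom w 0 s)) ->
  p < s < q ->
  mu.-integrable setT (EFin \o laplace_mom w k s).
Proof.
move=> w0 mw iw /andP[ps sq].
have [e e0 [pse sqe]] := itv_margin ps sq.
pose C := k`!%:R / e ^+ k.
have C0 : 0 <= C by rewrite divr_ge0// exprn_ge0// ltW.
apply: (@le_integrable _ _ _ mu setT measurableT _
  (fun z => C%:E * ((EFin \o laplace_mom w 0 (s - e)) z + (EFin \o laplace_mom w 0 (s + e)) z))%E).
- by apply/measurable_EFinP; exact: measurable_laplace_mom.
- move=> z _ /=.
  rewrite lee_fin /laplace_mom !expr0 !mul1r [leRHS]ger0_norm; last first.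
    by rewrite mulr_ge0// addr_ge0// mulr_ge0// expR_ge0.
  rewrite !normrM (ger0_norm (expR_ge0 _)) (ger0_norm (w0 _)).
  rewrite -mulrDl mulrA ler_wpM2r//.
  have -> : expR ((s - e) * z) + expR ((s + e) * z) =
      (expR (e * z) + expR (- (e * z))) * expR (s * z).
    rewrite [RHS]mulrDl -!expRD addrC; congr (expR _ + expR _); ring.
  rewrite mulrA ler_wpM2r ?expR_ge0//.
  apply: le_trans (ler_wpM2l C0 (expR_norm_le (e * z))).
  apply: le_trans (ler_wpM2l C0 (expR_ge_exprn_fact k (normr_ge0 _))).
  rewrite normrX normrM exprMn (gtr0_norm e0) /C le_eqVlt; apply/orP; left; apply/eqP.
  have ? : e ^+ k != 0 by rewrite expf_neq0// gt_eqF.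
  have ? : k`!%:R != 0 :> R by rewrite pnatr_eq0 -lt0n fact_gt0.
  by field; apply/andP.
- apply: integrableZl => //; apply: integrableD => //; apply: iw; lra.
Qed.

Definition laplace (R : realType) (w : R -> R) (k : nat) (s : R) : R :=
  Rintegral mu setT (laplace_mom w k s).

Lemma is_derive_laplace_mom (R : realType) (w : R -> R) k (s z : R) :
  is_derive s (1 : R) (laplace_mom w k ^~ z) (laplace_mom w k.+1 s z).
Proof.
have -> : laplace_mom w k ^~ z = (z ^+ k * w z) \*: (expR \o (z \*: id)).
  by apply/funext => t /=; rewrite /laplace_mom /GRing.scale/= [t * z]mulrC; ring.
apply: is_derive_eq.
rewrite /laplace_mom /= /GRing.scale/= [s * z]mulrC exprS; ring.
Qed.

(** Differentiation under the integral on ]s - e, s + e[. As exp(tz) is monotone in t, the next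
    moment is bounded there by the sum [G] of its absolute values at the two ends. *)
Lemma is_derive_laplace (R : realType) (w : R -> R) (p q : R) k s :
  (forall z, 0 <= w z) -> measurable_fun setT w ->
  (forall s, p < s < q -> mu.-integrable setT (EFin \o laplace_mom w 0 s)) ->
  p < s < q ->
  is_derive s (1 : R) (laplace w k) (laplace w k.+1 s).
Proof.
move=> w0 mw iw /andP[ps sq].
have [e e0 [pse sqe]] := itv_margin ps sq.
have intk k' t : p < t < q -> mu.-integrable setT (EFin \o laplace_mom w k' t).
  by move=> ?; apply: (@integrable_laplace_mom _ _ p q).
pose G z := `|laplace_mom w k.+1 (s - e) z| + `|laplace_mom w k.+1 (s + e) z|.
have G0 z : 0 <= G z by rewrite addr_ge0.
have iG : mu.-integrable setT (EFin \o G).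
  have iN t : p < t < q -> mu.-integrable setT (EFin \o (Num.norm \o laplace_mom w k.+1 t)).
    by move=> pt; apply: integrable_norm; exact: intk.
  apply: (@integrableD _ _ _ _ _ measurableT (EFin \o (Num.norm \o _)) (EFin \o (Num.norm \o _)));
    apply: iN; lra.
have Is : `]s - e, s + e[%classic s by rewrite /= in_itv/=; lra.
have intI t : `]s - e, s + e[%classic t -> mu.-integrable setT (EFin \o laplace_mom w k t).
  by rewrite /= in_itv/= => ?; apply: intk; lra.
have dI t z : `]s - e, s + e[%classic t -> setT z -> derivable (laplace_mom w k ^~ z) t 1.
  by move=> _ _; apply: ex_derive; exact: is_derive_laplace_mom.
have pE t z : partial1of2 (laplace_mom w k) t z = laplace_mom w k.+1 t z.
  rewrite partial1of2E; apply: derive_val; exact: is_derive_laplace_mom.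
have Gub t z : `]s - e, s + e[%classic t -> setT z -> `|partial1of2 (laplace_mom w k) t z| <= G z.
  rewrite /= in_itv/= => /andP[t1 t2] _; rewrite pE /G /laplace_mom !normrM !(ger0_norm (expR_ge0 _)).
  rewrite -mulrDl ler_wpM2r// -mulrDr ler_wpM2l//.
  (* The right end dominates for z >= 0, the left end for z < 0. *)
  have [z0|z0] := leP 0 z.
    by apply: ler_wpDl; rewrite ?expR_ge0// ler_expR ler_wpM2r// ltW.
  by apply: ler_wpDr; rewrite ?expR_ge0// ler_expR ler_wnM2r// ltW.
apply: DeriveDef; first exact: (derivable_under_integral measurableT Is intI dI G0 iG Gub).
rewrite -derive1E (differentiation_under_integral measurableT Is intI dI G0 iG Gub).
by apply: eq_Rintegral => z _; exact: pE.
Qed.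

(** * The Gamma function *)

Definition logistic (R : realType) (z : R) : R := expR z / (1 + expR z).

Lemma is_derive_logistic (R : realType) (x z : R) :
  is_derive z (1:R) (fun z => logistic (x * z)) (x * (expR (x * z) / (1 + expR (x * z)) ^+ 2)).
Proof.
have D0 : 1 + expR (x * z) != 0 by rewrite gt_eqF// addr_gt0// expR_gt0.
have -> : (fun z => logistic (x * z)) = cst 1 - (fun z => (1 + expR (x * z))^-1).
  apply/funext => t; rewrite /logistic/= !fctE.
  have D1 : 1 + expR (x * t) != 0 by rewrite gt_eqF// addr_gt0// expR_gt0.
  by field.
have H : is_derive z (1:R) (fun z => 1 + expR (x * z)) (x * expR (x * z)).
  have -> : (fun z => 1 + expR (x * z)) = cst 1 + (expR \o (x \*: id)) by apply/funext.
  by apply: is_derive_eq; rewrite /GRing.scale/=; ring.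
have HV := @is_deriveV R (fun z => 1 + expR (x * z)) z _ 1 D0 H.
apply: is_derive_eq; rewrite /GRing.scale/=; by field.
Qed.

Lemma range_logistic (R : realType) (x : R) : 0 < x ->
  range (fun z => logistic (x * z)) = `]0, 1[%classic.
Proof.
move=> x0; apply/seteqP; split => [_ [z _ <-]|y] /=; rewrite in_itv/=.
  have e0 := expR_gt0 (x * z).
  by rewrite /logistic divr_gt0 ?addr_gt0//= ltr_pdivrMr ?addr_gt0// mul1r ltrDr.
move=> /andP[y0 y1]; exists (ln (y / (1 - y)) / x) => //.
have y1' : 0 < 1 - y by rewrite subr_gt0.
rewrite /logistic mulrCA divff ?gt_eqF// mulr1 lnK ?posrE ?divr_gt0//.
by field; rewrite subrK oner_eq0 gt_eqF.
Qed.

Lemma range_expR (R : realType) : range (@expR R) = `]0, +oo[%classic.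
Proof.
apply/seteqP; split => [_ [z _ <-]|y] /=; rewrite in_itv/= andbT ?expR_gt0// => y0.
by exists (ln y) => //; rewrite lnK.
Qed.

Lemma continuous_powR (R : realType) (a t : R) : 0 < t -> {for t, continuous (fun t => powR t a)}.
Proof.
move=> t0; apply/differentiable_continuous/derivable1_diffP.
by apply: derivable_powR; rewrite in_itv/= t0.
Qed.

Lemma powR_expR (R : realType) (a z : R) : powR (expR z) a = expR (a * z).
Proof. by rewrite mulrC expRM. Qed.

Definition logistic_deriv (R : realType) (x z : R) := x * (expR (x * z) / (1 + expR (x * z)) ^+ 2).

Lemma continuous_expRM (R : realType) (x : R) : continuous (fun z => expR (x * z)).
Proof.
move=> z; apply: (@continuous_comp _ _ _ ( *%R x) expR); last exact: continuous_expR.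
exact: mulrl_continuous.
Qed.

Lemma continuous_logistic_deriv (R : realType) (x : R) : continuous (logistic_deriv x).
Proof.
move=> z; apply: cvgM; first exact: cvg_cst.
apply: cvgM; first exact: continuous_expRM.
apply: cvgV.
  by rewrite expf_neq0// gt_eqF// addr_gt0// expR_gt0.
apply: cvgM; (apply: cvgD; first exact: cvg_cst); exact: continuous_expRM.
Qed.

Lemma homo_logistic (R : realType) (x : R) : 0 < x -> {homo (fun z => logistic (x * z)) : y z / y < z}.
Proof.
move=> x0 y z yz; rewrite /logistic ltr_pdivrMr ?addr_gt0 ?expR_gt0//.
rewrite mulrAC ltr_pdivlMr ?addr_gt0 ?expR_gt0//.
by rewrite mulrDr mulr1 mulrDr mulr1 [_ * expR (x * y)]mulrC ltrD2r ltr_expR ltr_pM2l.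
Qed.

Lemma logistic_deriv_ge0 (R : realType) (x : R) : 0 < x -> forall z, 0 <= logistic_deriv x z.
Proof.
move=> x0 z; rewrite mulr_ge0 ?(ltW x0)// divr_ge0 ?expR_ge0// exprn_ge0// addr_ge0// expR_ge0.
Qed.

(** Substitution with [G] constant equal to 1 turns the integral into the length of ]0, 1[. *)
Lemma integrable_logistic_deriv (R : realType) (x : R) : 0 < x ->
  mu.-integrable setT (EFin \o logistic_deriv x).
Proof.
move=> x0; apply/integrableP; split.
  by apply/measurable_EFinP; apply: continuous_measurable_fun; exact: continuous_logistic_deriv.
have d0 := logistic_deriv_ge0 x0.
under eq_integral => z _ do rewrite /= ger0_norm// -[logistic_deriv x z]mul1r.
rewrite -(ge0_integral_subst (G := cst 1) (homo_logistic x0) (is_derive_logistic x)) //.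
- rewrite range_logistic// (eq_integral (cst 1%E))// integral_cst//= lebesgue_measure_itv/= lte_fin ltr01.
  by rewrite mul1e oppr0 adde0 ltry.
- exact: continuous_logistic_deriv.
- by move=> z; exact: cvg_cst.
Qed.

(* After the substitution t = exp z, Gamma is the Laplace transform of this
   weight. *)
Definition gamma_weight (R : realType) (z : R) : R := expR (- expR z).

Lemma measurable_gamma_weight (R : realType) : measurable_fun setT (@gamma_weight R).
Proof. by do 2 (apply: measurableT_comp => //). Qed.

(* This dominates the integrand of Gamma by a multiple of the derivative of
   [logistic (x * z)], whose integral over the line is 1. *)
Lemma gamma_weight_le (R : realType) (x : R) : 0 < x -> exists2 K, 0 <= K &
  forall z, gamma_weight z <= K * (1 + expR (x * z)) ^- 2.
Proof.
(* With u = exp(xz) and m >= 2x, (1 + u)^2 <= 2 (1 + u^2) <= 4 + 2 exp(mz), while exp(exp z) >= 1 +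
   exp(mz)/m!; hence the constant 4 m!. *)
move=> x0; pose m := (Num.truncn (2 * x)).+1.
have xm : 2 * x <= m%:R by apply/ltW; exact: truncnS_gt.
exists (4 * m`!%:R); first by rewrite mulr_ge0.
move=> z; rewrite ler_pdivlMr ?exprn_gt0 ?addr_gt0 ?expR_gt0//.
rewrite /gamma_weight expRN mulrC ler_pdivrMr ?expR_gt0//.
apply: le_trans (ler_wpM2l _ (expR_ge1Dxn m.-1 (expR_ge0 z))); last by rewrite mulr_ge0.
rewrite prednK//.
have e1 : expR (2 * x * z) <= 1 + expR z ^+ m.
  have [z0|z0] := leP 0 z.
    by rewrite -expRM_natl; apply: ler_wpDl => //; rewrite ler_expR ler_wpM2r.
  apply: ler_wpDr; first by rewrite exprn_ge0// expR_ge0.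
  by rewrite -expR0 ler_expR nmulr_lle0// mulr_ge0// ltW.
have e2 : expR (2 * x * z) = expR (x * z) ^+ 2 by rewrite -expRM_natl mulrA.
have F : 1 <= m`!%:R :> R by rewrite ler1n fact_gt0.
rewrite mulrDr mulr1 mulrCA -mulrA divff ?mulr1; last by rewrite gt_eqF// (lt_le_trans _ F).
have E0 : 0 <= expR z ^+ m by rewrite exprn_ge0// expR_ge0.
have := sqr_ge0 (expR (x * z) - 1); rewrite e2 in e1.
rewrite sqrrB sqrrD expr1n mul1r mulr1.
lra.
Qed.

(** Only k = 0 calls for the bound by the logistic derivative; the higher moments follow from
    convergence on an open interval. *)
Lemma integrable_gamma (R : realType) (x : R) k : 0 < x ->
  mu.-integrable setT (EFin \o laplace_mom (@gamma_weight R) k x).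
Proof.
have w0 z : 0 <= @gamma_weight R z by exact: expR_ge0.
(* The transform converges on all of ]0, +oo[; [x + 1] merely supplies a finite right end. *)
move=> x0; have x1 : 0 < x < x + 1 by lra.
apply: (integrable_laplace_mom k w0 (@measurable_gamma_weight R) _ x1).
move=> s /andP[s0 _].
have [K K0 KP] := gamma_weight_le s0.
apply: (@le_integrable _ _ _ mu setT measurableT _
  (fun z => (K / s)%:E * (EFin \o logistic_deriv s) z)%E).
- by apply/measurable_EFinP; apply: measurable_laplace_mom; exact: measurable_gamma_weight.
- move=> z _ /=.
  rewrite lee_fin /laplace_mom expr0 mul1r !ger0_norm; last 2 first.
  + by apply: mulr_ge0; [rewrite divr_ge0// ltW|exact: logistic_deriv_ge0].
  + by rewrite mulr_ge0// expR_ge0.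
  rewrite /logistic_deriv [leRHS](_ : _ = expR (s * z) * (K * (1 + expR (s * z)) ^- 2)).
    by rewrite ler_wpM2l ?expR_ge0.
  by rewrite -mulrA mulKf ?gt_eqF// mulrCA.
- by apply: integrableZl => //; exact: integrable_logistic_deriv.
Qed.

Lemma Gamma_laplace (R : realType) (x : R) : Gamma x = laplace (@gamma_weight R) 0 x.
Proof.
rewrite /Gamma /laplace /Rintegral; congr fine.
rewrite -range_expR (ge0_integral_subst _ (@is_derive_expR R)); last 4 first.
- by move=> ? ?; rewrite ltr_expR.
- exact: continuous_expR.
- move=> z; apply: cvgM; first by apply: continuous_powR; rewrite expR_gt0.
  apply: (@continuous_comp _ _ _ -%R expR); last exact: continuous_expR.
  exact: opp_continuous.
- by move=> z; rewrite mulr_ge0 ?powR_ge0 ?expR_ge0.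
apply: eq_integral => z _; congr EFin.
rewrite powR_expR /laplace_mom expr0 mul1r mulrAC -expRD; congr (expR _ * _); ring.
Qed.

Lemma integral_gt0 (R : realType) (f : R -> R) :
  measurable_fun setT f -> (forall x, 0 < f x) ->
  (0 < \int[mu]_x (f x)%:E)%E.
Proof.
move=> mf f0; rewrite lt_neqAle integral_ge0 ?andbT; last by move=> x _; rewrite lee_fin ltW.
apply/eqP => /esym f_eq0.
have : (\int[mu]_x `|(f x)%:E| = 0)%E.
  by rewrite -[RHS]f_eq0; apply: eq_integral => x _; rewrite gee0_abs// lee_fin ltW.
have mf' : measurable_fun setT (EFin \o f) by apply/measurable_EFinP.
move/(ae_eq_integral_abs mu measurableT mf') => [A [mA A0 sA]].
(* If the integral vanished, the null set [A] would contain every point where [f] is nonzero, that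
   is the whole line, and so a segment of measure 1. *)
have : (mu `[0%R, 1%R]%classic <= mu A)%E.
  apply: le_measure; rewrite ?inE//.
  move=> x _; apply: sA => /(_ Logic.I)/eqP.
  by rewrite eqe gt_eqF.
by rewrite A0 lebesgue_measure_itv/= lte_fin ltr01 oppr0 adde0 lee_fin leNgt ltr01.
Qed.

Lemma integral_laplace (R : realType) (w : R -> R) k s :
  mu.-integrable setT (EFin \o laplace_mom w k s) ->
  (\int[mu]_z (laplace_mom w k s z)%:E = (laplace w k s)%:E)%E.
Proof. by move=> iw; rewrite fineK//; exact: integrable_fin_num iw. Qed.

Lemma Gamma_gt0 (R : realType) (x : R) : 0 < x -> 0 < Gamma x.
Proof.
move=> x0; rewrite Gamma_laplace -lte_fin -integral_laplace; last exact: integrable_gamma.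
apply: integral_gt0; first by apply: measurable_laplace_mom; exact: measurable_gamma_weight.
by move=> z; rewrite /laplace_mom expr0 mul1r mulr_gt0// expR_gt0.
Qed.

(** * The Beta function and its logarithmic moments *)

Lemma ge0_integral_shift (R : realType) (c : R) (G : R -> R) : continuous G -> (forall x, 0 <= G x) ->
  (\int[mu]_x (G (x + c))%:E = \int[mu]_x (G x)%:E)%E.
Proof.
move=> cG G0.
have dF (x : R) : is_derive x (1:R) (fun x => x + c) 1.
  by have := is_deriveD (is_derive_id x (1:R)) (is_derive_cst c x (1:R)); rewrite addr0.
have Fi : {homo (fun x => x + c) : x y / x < y} by move=> x y; rewrite ltrD2r.
under eq_integral do rewrite -[G _]mulr1.
rewrite -(ge0_integral_subst Fi dF (fun=> cvg_cst _) (fun=> cG _) (fun=> G0 _)).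
congr integral.
by apply/seteqP; split => // y _; exists (y - c) => //; rewrite subrK.
Qed.

(* After the substitution t = logistic z, B(s, c - s) is the Laplace transform
   at [s] of this weight. *)
Definition beta_weight (R : realType) (c z : R) : R := powR (1 + expR z) (- c).

Lemma continuous_beta_weight (R : realType) (c : R) : continuous (@beta_weight R c).
Proof.
move=> z; apply: (@continuous_comp _ _ _ (fun z => 1 + expR z) (fun t => powR t (- c))).
  apply: cvgD; [exact: cvg_cst|exact: continuous_expR].
by apply: continuous_powR; rewrite addr_gt0// expR_gt0.
Qed.

Lemma continuous_laplace_mom (R : realType) (w : R -> R) k s : continuous w -> continuous (laplace_mom w k s).
Proof.
move=> cw z; apply: cvgM; last exact: cw.
by apply: cvgM; [exact: exprn_continuous|exact: continuous_expRM].
Qed.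

Lemma ge0_integralZl_EFinR (R : realType) (f : R -> R) (k : R) :
  measurable_fun setT f -> (forall x, 0 <= f x) -> 0 <= k ->
  (\int[mu]_x (k * f x)%:E = k%:E * \int[mu]_x (f x)%:E)%E.
Proof.
move=> mf f0 k0; rewrite -ge0_integralZl//; first by apply/measurable_EFinP.
by move=> x _; rewrite lee_fin.
Qed.

(* In logarithmic coordinates Gamma s * Gamma (c - s) is a double integral over
   (x, y); put x = u + y, exchange the integrals, and shift y by
   ln (1 + exp u). *)
Lemma Gamma_beta_weight (R : realType) (s c : R) : 0 < s < c ->
  ((Gamma c)%:E * \int[mu]_z (laplace_mom (beta_weight c) 0 s z)%:E =
   (Gamma s * Gamma (c - s))%:E)%E.
Proof.
move=> /andP[s0 sc]; have cs0 : 0 < c - s by rewrite subr_gt0.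
have c0 : 0 < c by exact: lt_trans sc.
pose g t := laplace_mom (@gamma_weight R) 0 t.
have g0 t z : 0 <= g t z by rewrite /g /laplace_mom expr0 mul1r mulr_ge0// expR_ge0.
have mg t : measurable_fun setT (g t) by apply: measurable_laplace_mom; exact: measurable_gamma_weight.
have cg t : continuous (g t).
  apply: continuous_laplace_mom => z; apply: (@continuous_comp _ _ _ (fun z => - expR z) expR).
    by apply: cvgN; exact: continuous_expR.
  exact: continuous_expR.
have intg t : 0 < t -> (\int[mu]_z (g t z)%:E = (Gamma t)%:E)%E.
  by move=> t0; rewrite Gamma_laplace integral_laplace//; exact: integrable_gamma.
pose f (uy : R * R) := (g s (uy.1 + uy.2) * g (c - s) uy.2)%:E.
have mf : measurable_fun setT f.
  apply/measurable_EFinP; apply: measurable_funM; apply: measurableT_comp => //.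
  exact: measurable_funD.
have f0 uy : (0 <= f uy)%E by rewrite lee_fin mulr_ge0.
transitivity (\int[mu]_u \int[mu]_y f (u, y))%E.
  rewrite -ge0_integralZl//; last 3 first.
  - apply/measurable_EFinP; apply: measurable_laplace_mom.
    by apply: continuous_measurable_fun; exact: continuous_beta_weight.
  - by move=> z _; rewrite lee_fin /laplace_mom expr0 mul1r mulr_ge0 ?expR_ge0 ?powR_ge0.
  - by rewrite lee_fin ltW// Gamma_gt0.
  apply: eq_integral => u _.
  have e0 : 0 < 1 + expR u by rewrite addr_gt0// expR_gt0.
  pose d := ln (1 + expR u).
  have fE y : f (u, y) = (laplace_mom (beta_weight c) 0 s u * g c (y + d))%:E.
    rewrite /f/=; congr EFin.
    have ed : expR d = 1 + expR u by rewrite lnK.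
    have ey : expR (y + d) = expR y + expR (u + y) by rewrite !expRD ed; ring.
    rewrite /g /laplace_mom /beta_weight /gamma_weight !expr0 !mul1r ey -ed powR_expR -!expRD.
    by congr expR; ring.
  under [RHS]eq_integral do rewrite fE.
  rewrite (@ge0_integralZl_EFinR _ (fun y => g c (y + d)))//.
  - by rewrite ge0_integral_shift// intg// muleC.
  - by apply: (measurableT_comp (mg c)); exact: measurable_funD.
  - by rewrite /laplace_mom expr0 mul1r mulr_ge0 ?expR_ge0 ?powR_ge0.
(* In the other order, for fixed y, the inner integral over u is a translate of the one for Gamma s,
   and the factor in y integrates to Gamma (c - s). *)
rewrite fubini_tonelli//.
rewrite EFinM -[X in (_ * X)%E]intg// -ge0_integralZl_EFinR//; last by rewrite ltW// Gamma_gt0.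
apply: eq_integral => y _.
under eq_integral do rewrite /f/= mulrC.
rewrite (@ge0_integralZl_EFinR _ (fun x => g s (x + y)))//.
  by rewrite ge0_integral_shift// intg// -EFinM mulrC.
by apply: (measurableT_comp (mg s)); exact: measurable_funD.
Qed.

Lemma measurable_beta_weight (R : realType) (c : R) : measurable_fun setT (beta_weight c).
Proof. by apply: continuous_measurable_fun; exact: continuous_beta_weight. Qed.

(** An infinite integral, multiplied by Gamma c > 0, could not equal the finite product Gamma s *
    Gamma (c - s). *)
Lemma integrable_beta0 (R : realType) (s c : R) : 0 < s < c ->
  mu.-integrable setT (EFin \o laplace_mom (beta_weight c) 0 s).
Proof.
move=> sc; have c0 : 0 < c by case/andP: sc; exact: lt_trans.
apply/integrableP; split.
  by apply/measurable_EFinP; apply: measurable_laplace_mom; exact: measurable_beta_weight.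
under eq_integral => z _.
  rewrite /= ger0_norm; first over.
  by rewrite /laplace_mom expr0 mul1r mulr_ge0 ?expR_ge0 ?powR_ge0.
rewrite /= ltey; apply/eqP => I_oo.
by have := Gamma_beta_weight sc; rewrite I_oo gt0_muley ?lte_fin ?Gamma_gt0.
Qed.

Lemma integrable_beta (R : realType) (s c : R) k : 0 < s < c ->
  mu.-integrable setT (EFin \o laplace_mom (beta_weight c) k s).
Proof.
apply: integrable_laplace_mom; [by move=> z; exact: powR_ge0|exact: measurable_beta_weight|].
by move=> t; exact: integrable_beta0.
Qed.

Lemma laplace_beta0 (R : realType) (s c : R) : 0 < s < c ->
  laplace (beta_weight c) 0 s = Gamma s * Gamma (c - s) / Gamma c.
Proof.
move=> sc; have c0 : 0 < c by case/andP: sc; exact: lt_trans.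
have := Gamma_beta_weight sc; rewrite integral_laplace ?integrable_beta// -EFinM => -[<-].
by rewrite mulrC mulKf// gt_eqF// Gamma_gt0.
Qed.

Lemma Beta_laplace (R : realType) (a b : R) : Beta a b = laplace (beta_weight (a + b)) 0 a.
Proof.
rewrite /Beta /laplace /Rintegral; congr fine.
have x0 := @ltr01 R.
rewrite -(range_logistic x0) (ge0_integral_subst (homo_logistic x0) (is_derive_logistic 1));
  last 3 first.
- exact: continuous_logistic_deriv.
- move=> z; have : range (fun z : R => logistic (1 * z)) (logistic (1 * z)) by exists z.
  rewrite range_logistic//= in_itv/= => /andP[l0 l1].
  apply: cvgM; first by apply: continuous_powR.
  apply: (@continuous_comp _ _ _ (fun t : R => 1 - t) (fun t => powR t (b - 1))).
    by apply: cvgB; [exact: cvg_cst|exact: cvg_id].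
  by apply: continuous_powR; rewrite subr_gt0.
- by move=> z; rewrite mulr_ge0 ?powR_ge0.
apply: eq_integral => z _; congr EFin.
have e0 : 0 < 1 + expR z by rewrite addr_gt0// expR_gt0.
pose d := ln (1 + expR z).
have ed : 1 + expR z = expR d by rewrite lnK.
rewrite /logistic !mul1r.
have -> : 1 - expR z / (1 + expR z) = (1 + expR z)^-1.
  by field; rewrite gt_eqF.
rewrite /laplace_mom expr0 mul1r /beta_weight ed -!expRN -expRD !powR_expR.
rewrite -exprVn -expRN -expRM_natl -!expRD.
by congr expR; ring.
Qed.

Lemma Beta_Gamma (R : realType) (a b : R) : 0 < a -> 0 < b ->
  Beta a b = Gamma a * Gamma b / Gamma (a + b).
Proof.
by move=> a0 b0; rewrite Beta_laplace laplace_beta0 ?a0 ?ltrDl// [a + b - a]addrAC subrr add0r.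
Qed.

(** * Digamma and trigamma through the moments of the Gamma weight *)

Lemma is_derive_gamma_laplace (R : realType) k (x : R) : 0 < x ->
  is_derive x (1 : R) (laplace (@gamma_weight R) k) (laplace (@gamma_weight R) k.+1 x).
Proof.
move=> x0; apply: (@is_derive_laplace _ _ 0 (x + 1)).
- by move=> z; exact: expR_ge0.
- exact: measurable_gamma_weight.
- by move=> s /andP[s0 _]; exact: integrable_gamma.
- by rewrite x0 ltrDl ltr01.
Qed.

Lemma Gamma_laplaceE (R : realType) : @Gamma R = laplace (@gamma_weight R) 0.
Proof. by apply/funext => x; exact: Gamma_laplace. Qed.

Lemma digammaE (R : realType) (x : R) : 0 < x ->
  digamma x = laplace (@gamma_weight R) 1 x / Gamma x.
Proof.
move=> x0; rewrite /digamma derive1E.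
have dG := is_derive_gamma_laplace 0 x0; rewrite -Gamma_laplaceE in dG.
have dl := is_derive1_ln (Gamma_gt0 x0).
have [_ E] := is_derive1_comp dl dG.
by rewrite [LHS]E mulrC.
Qed.

Lemma trigammaE (R : realType) (x : R) : 0 < x ->
  trigamma x = laplace (@gamma_weight R) 2 x / Gamma x - digamma x ^+ 2.
Proof.
move=> x0; rewrite /trigamma derive1E.
(* [digammaE] is available on the positive reals, a neighbourhood of [x]; the quotient rule then
   applies. *)
have -> : 'D_1 (@digamma R) x = 'D_1 (fun x => laplace (@gamma_weight R) 1 x / Gamma x) x.
  apply: near_eq_derive.
  near=> y; apply: digammaE; near: y; exact: lt_nbhsr.
have dG := is_derive_gamma_laplace 0 x0; rewrite -Gamma_laplaceE in dG.
have d1 := is_derive_gamma_laplace 1 x0.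
have G0 : Gamma x != 0 by rewrite gt_eqF// Gamma_gt0.
have dV := is_deriveV G0 dG.
have [_ E] := is_deriveM d1 dV.
rewrite [X in X = _]E digammaE// /GRing.scale/=; by field.
Unshelve. all: by end_near. Qed.

(** * Moments of the Beta weight by differentiating the Gamma quotient *)

Lemma is_derive_beta_laplace (R : realType) k (s c : R) : 0 < s < c ->
  is_derive s (1 : R) (laplace (beta_weight c) k) (laplace (beta_weight c) k.+1 s).
Proof.
move=> sc; apply: (@is_derive_laplace _ _ 0 c) => //.
- by move=> z; exact: powR_ge0.
- exact: measurable_beta_weight.
- by move=> t; exact: integrable_beta.
Qed.

Lemma is_derive_gamma_laplace_sub (R : realType) k (s c : R) : s < c ->
  is_derive s (1 : R) (fun s => laplace (@gamma_weight R) k (c - s))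
    (- laplace (@gamma_weight R) k.+1 (c - s)).
Proof.
move=> sc; have d : is_derive s (1 : R) (fun s => c - s) (- 1).
  by rewrite -[- 1]add0r; exact: is_deriveB.
have cs : 0 < c - s by rewrite subr_gt0.
have := is_derive1_comp (g := fun s => c - s) (is_derive_gamma_laplace k cs) d.
by rewrite mulrN1.
Qed.

(** This allows an identity valid on an open interval to be differentiated on both sides. *)
Lemma is_derive_near_unique (R : realType) (p q s : R) (f g : R -> R) (df dg : R) : p < s < q ->
  (forall t, p < t < q -> f t = g t) -> is_derive s (1 : R) f df -> is_derive s (1 : R) g dg -> df = dg.
Proof.
move=> /andP[ps sq] fg [_ <-] [_ <-]; apply: near_eq_derive.
by near=> t; apply: fg; apply/andP; split; near: t; [exact: lt_nbhsr|exact: lt_nbhsl].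
Unshelve. all: by end_near. Qed.

(** For 0 < s < c this is the product of the j-th derivative of Gamma at s and the k-th at c - s,
    over Gamma c. Differences of such terms are stable under differentiation in s. *)
Definition Gamma_conv (R : realType) (c : R) (j k : nat) (s : R) : R :=
  laplace (@gamma_weight R) j s * laplace (@gamma_weight R) k (c - s) / Gamma c.

Lemma is_derive_Gamma_conv (R : realType) (c s : R) j k : 0 < s < c ->
  is_derive s (1 : R) (Gamma_conv c j k) (Gamma_conv c j.+1 k s - Gamma_conv c j k.+1 s).
Proof.
move=> /andP[s0 sc].
have d1 := is_derive_gamma_laplace j s0.
have d2 := is_derive_gamma_laplace_sub k sc.
have -> : Gamma_conv c j k =
    (Gamma c)^-1 \*: (laplace (@gamma_weight R) j * (fun s => laplace (@gamma_weight R) k (c - s))).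
  by apply/funext => t; rewrite /Gamma_conv mulrC.
by apply: is_derive_eq; rewrite /Gamma_conv /GRing.scale/=; ring.
Qed.

Lemma laplace_beta0_conv (R : realType) (s c : R) : 0 < s < c ->
  laplace (beta_weight c) 0 s = Gamma_conv c 0 0 s.
Proof. by move=> sc; rewrite laplace_beta0// /Gamma_conv -Gamma_laplaceE. Qed.

(** The identity of order 0 is differentiated in s: the left side moves to the next moment, the
    right side follows the product rule, with a minus sign from c - s. *)
Lemma laplace_beta1_conv (R : realType) (s c : R) : 0 < s < c ->
  laplace (beta_weight c) 1 s = Gamma_conv c 1 0 s - Gamma_conv c 0 1 s.
Proof.
move=> sc; apply: (is_derive_near_unique sc (@laplace_beta0_conv R ^~ c)).
  exact: is_derive_beta_laplace.
exact: is_derive_Gamma_conv.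
Qed.

Lemma laplace_beta2_conv (R : realType) (s c : R) : 0 < s < c ->
  laplace (beta_weight c) 2 s = Gamma_conv c 2 0 s - Gamma_conv c 1 1 s *+ 2 + Gamma_conv c 0 2 s.
Proof.
move=> sc; have d10 := is_derive_Gamma_conv 1 0 sc; have d01 := is_derive_Gamma_conv 0 1 sc.
have := is_derive_near_unique sc (@laplace_beta1_conv R ^~ c)
  (is_derive_beta_laplace 1 sc) (is_deriveB d10 d01).
by move=> ->; ring.
Qed.

Lemma laplace_beta1 (R : realType) (s c : R) : 0 < s < c ->
  laplace (beta_weight c) 1 s = laplace (beta_weight c) 0 s * (digamma s - digamma (c - s)).
Proof.
move=> sc; rewrite laplace_beta1_conv// laplace_beta0//.
case/andP: sc => s0; rewrite -subr_gt0 => cs0.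
rewrite !digammaE// /Gamma_conv -!Gamma_laplaceE.
have := Gamma_gt0 s0; have := Gamma_gt0 cs0; have : 0 < Gamma c.
  by apply: Gamma_gt0; rewrite -(subrK s c) addr_gt0.
move=> /gt_eqF/negbT + /gt_eqF/negbT + /gt_eqF/negbT.
move: (Gamma c) (Gamma s) (Gamma (c - s)) (laplace _ _ s) (laplace _ _ (c - s)) => C A B A1 B1 ? ? ?.
by field; repeat (apply/andP; split).
Qed.

(** This is L'' = L ((ln L)'' + ((ln L)')^2) for L(s) = Gamma s * Gamma (c - s) / Gamma c. *)
Lemma laplace_beta2 (R : realType) (s c : R) : 0 < s < c ->
  laplace (beta_weight c) 2 s =
  laplace (beta_weight c) 0 s * (trigamma s + trigamma (c - s) + (digamma s - digamma (c - s)) ^+ 2).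
Proof.
move=> sc; rewrite laplace_beta2_conv// laplace_beta0//.
case/andP: sc => s0; rewrite -subr_gt0 => cs0.
rewrite !trigammaE// !digammaE// /Gamma_conv -!Gamma_laplaceE.
have := Gamma_gt0 s0; have := Gamma_gt0 cs0; have : 0 < Gamma c.
  by apply: Gamma_gt0; rewrite -(subrK s c) addr_gt0.
move=> /gt_eqF/negbT + /gt_eqF/negbT + /gt_eqF/negbT.
move: (Gamma c) (Gamma s) (Gamma (c - s)) (laplace _ 1 s) (laplace _ 1 (c - s))
  (laplace _ 2 s) (laplace _ 2 (c - s)).
move=> C A B A1 B1 A2 B2 ? ? ?.
by field; repeat (apply/andP; split).
Qed.

(** * The integral of the squared score against the Beta weight *)

Definition has_integral (R : realType) (f : R -> R) (v : R) :=
  mu.-integrable setT (EFin \o f) /\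
  (\int[mu]_x (f x)%:E = v%:E)%E.

Lemma has_integralD (R : realType) (f g : R -> R) (u v : R) :
  has_integral f u -> has_integral g v -> has_integral (fun x => f x + g x) (u + v).
Proof.
move=> [if_ ef] [ig eg]; split.
  exact: (integrableD measurableT if_ ig).
by rewrite EFinD -ef -eg -(integralD_EFin measurableT if_ ig).
Qed.

Lemma has_integralZ (R : realType) (k : R) (f : R -> R) (u : R) :
  has_integral f u -> has_integral (fun x => k * f x) (k * u).
Proof.
move=> [if_ ef]; split.
  exact: (integrableZl measurableT k if_).
by rewrite EFinM -ef -(integralZl measurableT if_).
Qed.

(** [Beta_laplace] evaluates the transform at the first argument; the symmetry of the Gamma quotient
    moves it to the second, where b_0 will stand. *)
Lemma laplace_beta_Beta (R : realType) (a b : R) : 0 < a -> 0 < b ->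
  laplace (beta_weight (a + b)) 0 b = Beta a b.
Proof.
move=> a0 b0; rewrite laplace_beta0 ?b0 ?ltrDr// addrK Beta_Gamma//.
by rewrite [X in X / _]mulrC.
Qed.

Lemma has_integral_beta (R : realType) (a b : R) k : 0 < a -> 0 < b ->
  has_integral (laplace_mom (beta_weight (a + b)) k b) (laplace (beta_weight (a + b)) k b).
Proof.
move=> a0 b0; have ib : mu.-integrable setT (EFin \o laplace_mom (beta_weight (a + b)) k b).
  by apply: integrable_beta; rewrite b0 ltrDr.
by split => //; exact: integral_laplace.
Qed.

Lemma has_integral_beta0 (R : realType) (a b : R) : 0 < a -> 0 < b ->
  has_integral (laplace_mom (beta_weight (a + b)) 0 b) (Beta a b).
Proof.
by move=> a0 b0; have := has_integral_beta 0 a0 b0; rewrite laplace_beta_Beta.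
Qed.

Lemma has_integral_beta1 (R : realType) (a b : R) : 0 < a -> 0 < b ->
  has_integral (laplace_mom (beta_weight (a + b)) 1 b) (Beta a b * (digamma b - digamma a)).
Proof.
move=> a0 b0; have bab : 0 < b < a + b by rewrite b0 ltrDr.
have := has_integral_beta 1 a0 b0.
by rewrite (laplace_beta1 bab) (laplace_beta_Beta a0 b0) addrK.
Qed.

Lemma has_integral_beta2 (R : realType) (a b : R) : 0 < a -> 0 < b ->
  has_integral (laplace_mom (beta_weight (a + b)) 2 b)
    (Beta a b * (trigamma b + trigamma a + (digamma b - digamma a) ^+ 2)).
Proof.
move=> a0 b0; have bab : 0 < b < a + b by rewrite b0 ltrDr.
have := has_integral_beta 2 a0 b0.
by rewrite (laplace_beta2 bab) (laplace_beta_Beta a0 b0) addrK.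
Qed.

(** The factor v^k = exp(kz) (1 + exp z)^(-k) raises s and c together and keeps c - s fixed; this is
    why one [a] goes with every b_k. *)
Lemma laplace_mom_beta_shift (R : realType) (c s z : R) j k :
  laplace_mom (beta_weight (c + k%:R)) j (s + k%:R) z =
  logistic z ^+ k * laplace_mom (beta_weight c) j s z.
Proof.
have e0 : 0 < 1 + expR z by rewrite addr_gt0// expR_gt0.
have [d ed] : exists d, 1 + expR z = expR d by exists (ln (1 + expR z)); rewrite lnK.
rewrite /laplace_mom /beta_weight /logistic ed !powR_expR -expRB -expRM_natl.
rewrite -!mulrA [RHS]mulrCA -!expRD; congr (_ * expR _); ring.
Qed.

(** With v the logistic function, the square is 1 + i^2 z^2 + N^2 v^2 z^2 + 2iz - 2Nvz - 2iN v z^2;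
    each v is absorbed as a shift of b. The six terms come in the order of C_1 to C_6. *)
Lemma integral_sqr_beta (R : realType) (a b i N : R) : 0 < a -> 0 < b ->
  (\int[mu]_z ((1 + (i - N * logistic z) * z) ^+ 2 * laplace_mom (beta_weight (a + b)) 0 b z)%:E =
   (Beta a b + i ^+ 2 * (Beta a b * (trigamma b + trigamma a + (digamma b - digamma a) ^+ 2))
   + N ^+ 2 * (Beta a (b + 2%:R) * (trigamma (b + 2%:R) + trigamma a
                                 + (digamma (b + 2%:R) - digamma a) ^+ 2))
   + 2 * i * (Beta a b * (digamma b - digamma a))
   + - (2 * N) * (Beta a (b + 1%:R) * (digamma (b + 1%:R) - digamma a))
   + - (2 * i * N) * (Beta a (b + 1%:R) * (trigamma (b + 1%:R) + trigamma a
                                       + (digamma (b + 1%:R) - digamma a) ^+ 2)))%:E)%E.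
Proof.
move=> a0 b0; have b1 : 0 < b + 1%:R by rewrite addr_gt0.
have b2 : 0 < b + 2%:R by rewrite addr_gt0.
have [_ <-] := has_integralD (has_integralD (has_integralD (has_integralD (has_integralD
  (has_integral_beta0 a0 b0) (has_integralZ (i ^+ 2) (has_integral_beta2 a0 b0)))
  (has_integralZ (N ^+ 2) (has_integral_beta2 a0 b2)))
  (has_integralZ (2 * i) (has_integral_beta1 a0 b0)))
  (has_integralZ (- (2 * N)) (has_integral_beta1 a0 b1)))
  (has_integralZ (- (2 * i * N)) (has_integral_beta2 a0 b1)).
apply: eq_integral => z _; congr EFin.
rewrite (addrA a b 1%:R) (addrA a b 2%:R).
rewrite (laplace_mom_beta_shift (a + b) b z 1 1) (laplace_mom_beta_shift (a + b) b z 2 1).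
rewrite (laplace_mom_beta_shift (a + b) b z 2 2) /laplace_mom.
move: (logistic z) (beta_weight _ z) (expR (b * z)) => v w e.
ring.
Qed.

(** * The order-statistic density *)

Lemma cc_gt0 (R : realType) (i n : nat) : 0 < cc R i n.
Proof. by rewrite /cc divr_gt0 ?mulr_gt0 ?ltr0n ?fact_gt0. Qed.

(** In exponential form the logarithm and the power tau + 1 of the density both act directly on the
    exponent. *)
Lemma fosE (R : realType) (n i : nat) (alpha beta x : R) : 0 < alpha -> 0 < beta -> 0 < x ->
  let l := ln (x / alpha) in
  fos n i alpha beta x =
  expR (ln (cc R i n) + ln beta - ln alpha + (i%:R * beta - 1) * l
        - n.+1%:R * ln (1 + expR (beta * l))).
Proof.
move=> a0 b0 x0 /=.
have y0 : 0 < x / alpha by rewrite divr_gt0.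
rewrite /fos -[in powR _ _](lnK (y0 : x / alpha \is Num.pos)).
rewrite -[in powR _ beta](lnK (y0 : x / alpha \is Num.pos)).
rewrite !powR_expR; set l := ln (x / alpha).
have D0 : 0 < 1 + expR (beta * l) by rewrite addr_gt0// expR_gt0.
rewrite expRB !expRD expRN expRM_natl !lnK ?posrE ?cc_gt0//.
by field; rewrite !gt_eqF// exprn_gt0.
Qed.

Lemma derive1_ln_fos (R : realType) (n i : nat) (alpha beta x : R) : 0 < alpha -> 0 < beta -> 0 < x ->
  let l := ln (x / alpha) in
  derive1 (fun b : R => ln (fos n i alpha b x)) beta =
  beta^-1 + (i%:R - n.+1%:R * logistic (beta * l)) * l.
Proof.
move=> a0 b0 x0 l; rewrite derive1E.
pose h b := ln (cc R i n) + ln b - ln alpha + (i%:R * b - 1) * l - n.+1%:R * ln (1 + expR (b * l)).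
(* The exponential form requires b > 0, which holds for b near [beta]. *)
have -> : 'D_1 (fun b : R => ln (fos n i alpha b x)) beta = 'D_1 h beta.
  apply: near_eq_derive; near=> b; rewrite fosE ?expRK//; near: b; exact: lt_nbhsr.
have D0 : 0 < 1 + expR (beta * l) by rewrite addr_gt0// expR_gt0.
have dlin (k m : R) : is_derive beta (1 : R) (fun b => k * b + m) k.
  have -> : (fun b => k * b + m) = k \*: id + cst m by apply/funext.
  by apply: is_derive_eq; rewrite /GRing.scale/= mulr1 addr0.
have dexp : is_derive beta (1 : R) (fun b => 1 + expR (b * l)) (expR (beta * l) * l).
  have -> : (fun b => 1 + expR (b * l)) = cst 1 + (expR \o (l \*: id)).
    by apply/funext => b; rewrite !fctE/= mulrC.
  by apply: is_derive_eq; rewrite /= /GRing.scale/= (mulrC l beta); ring.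
have dln := is_derive1_comp (g := fun b => 1 + expR (b * l)) (is_derive1_ln D0) dexp.
have dlb := is_derive1_ln b0.
have -> : h = (fun b => i%:R * l * b + (ln (cc R i n) - ln alpha - l)) + @ln R
              - n.+1%:R \*: (@ln R \o (fun b => 1 + expR (b * l))).
  by apply/funext => b; rewrite /h !fctE/= /GRing.scale/=; ring.
have d1 := is_deriveD (dlin (i%:R * l) (ln (cc R i n) - ln alpha - l)) dlb.
have d2 := is_deriveZ (n.+1%:R : R) dln.
have [_ ->] := is_deriveB d1 d2.
by rewrite /logistic /GRing.scale/=; field; rewrite !gt_eqF.
Unshelve. all: by end_near. Qed.

(** * Passage from x to the logit variable z *)

Lemma range_scaled_expR (R : realType) (alpha beta : R) :
  0 < alpha -> 0 < beta ->
  range (fun z => alpha * expR (beta^-1 * z)) = `]0, +oo[%classic.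
Proof.
move=> al0 be0; apply/seteqP; split => [_ [z _ <-]|x] /=; rewrite in_itv/= andbT.
  by rewrite mulr_gt0// expR_gt0.
move=> x0; exists (beta * ln (x / alpha)) => //.
rewrite mulKf ?gt_eqF// lnK ?posrE ?divr_gt0// mulrC divfK// gt_eqF//.
Qed.

Lemma is_derive_scaled_expR (R : realType) (alpha beta z : R) :
  is_derive z (1 : R) (fun z => alpha * expR (beta^-1 * z)) (alpha / beta * expR (beta^-1 * z)).
Proof.
have -> : (fun z => alpha * expR (beta^-1 * z)) = alpha \*: (expR \o (beta^-1 \*: id)) by apply/funext.
by apply: is_derive_eq; rewrite /= /GRing.scale/=; ring.
Qed.

Lemma continuous_logistic (R : realType) (x : R) : continuous (fun z => logistic (x * z)).
Proof.
move=> z; apply/differentiable_continuous/derivable1_diffP.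
by apply: ex_derive; exact: is_derive_logistic.
Qed.

Lemma continuous_ln1expR (R : realType) (x : R) : continuous (fun z => ln (1 + expR (x * z))).
Proof.
move=> z; apply: (@continuous_comp _ _ _ (fun z => 1 + expR (x * z)) (@ln R)).
  by apply: cvgD; [exact: cvg_cst|exact: continuous_expRM].
by apply: continuous_ln; rewrite addr_gt0// expR_gt0.
Qed.

(* The integrand of [Jtau] in the variable l = ln (x / alpha). *)
Definition fos_integrand (R : realType) (n i : nat) (alpha beta tau l : R) : R :=
  (beta^-1 + (i%:R - n.+1%:R * logistic (beta * l)) * l) ^+ 2 *
  expR ((tau + 1) * (ln (cc R i n) + ln beta - ln alpha + (i%:R * beta - 1) * l
                     - n.+1%:R * ln (1 + expR (beta * l)))).

Lemma continuous_fos_integrand (R : realType) (n i : nat) (alpha beta tau : R) :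
  continuous (fos_integrand n i alpha beta tau).
Proof.
move=> l; apply: cvgM.
  have h : (fun l => beta^-1 + (i%:R - n.+1%:R * logistic (beta * l)) * l) l0 @[l0 --> l] -->
      beta^-1 + (i%:R - n.+1%:R * logistic (beta * l)) * l.
    apply: cvgD; first exact: cvg_cst.
    apply: cvgM; last exact: cvg_id.
    apply: cvgB; first exact: cvg_cst.
    by apply: cvgM; [exact: cvg_cst|exact: continuous_logistic].
  by rewrite expr2; apply: cvgM.
apply: (@continuous_comp _ _ _ (fun l => (tau + 1) *
  (ln (cc R i n) + ln beta - ln alpha + (i%:R * beta - 1) * l
   - n.+1%:R * ln (1 + expR (beta * l)))) expR); last exact: continuous_expR.
apply: cvgM; first exact: cvg_cst.
apply: cvgB; last by apply: cvgM; [exact: cvg_cst|exact: continuous_ln1expR].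
apply: cvgD; first exact: cvg_cst.
by apply: cvgM; [exact: cvg_cst|exact: cvg_id].
Qed.

(** The squared score yields beta^(-2) times the square in z. The other factors, Jacobian included,
    are written as exponentials, and only their exponents are compared. *)
Lemma fos_integrand_subst (R : realType) (n i : nat) (alpha beta tau z : R) :
  0 < alpha -> 0 < beta ->
  fos_integrand n i alpha beta tau (beta^-1 * z) * (alpha / beta * expR (beta^-1 * z)) =
  powR (beta / alpha) tau * powR (cc R i n) (tau + 1) / beta ^+ 2 *
  ((1 + (i%:R - n.+1%:R * logistic z) * z) ^+ 2 *
   laplace_mom (beta_weight (n.+1%:R * (tau + 1))) 0 (((i%:R * beta - 1) * (tau + 1) + 1) / beta) z).
Proof.
move=> al0 be0.
have [la ela] : exists la, alpha = expR la by exists (ln alpha); rewrite lnK.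
have [lb elb] : exists lb, beta = expR lb by exists (ln beta); rewrite lnK.
have [lc elc] : exists lc, cc R i n = expR lc by exists (ln (cc R i n)); rewrite lnK// posrE cc_gt0.
have [d ed] : exists d, 1 + expR z = expR d.
  by exists (ln (1 + expR z)); rewrite lnK// posrE addr_gt0// expR_gt0.
have bn0 : beta != 0 by rewrite gt_eqF.
rewrite /fos_integrand mulVKf// ed.
have -> : beta^-1 + (i%:R - n.+1%:R * logistic z) * (beta^-1 * z) =
    beta^-1 * (1 + (i%:R - n.+1%:R * logistic z) * z).
  by ring.
rewrite exprMn; move: (1 + (i%:R - _ * logistic z) * z) => Q.
rewrite /laplace_mom /beta_weight ed expr0 mul1r.
have -> : alpha / beta = expR (la - lb) by rewrite ela elb expRB.
have -> : beta / alpha = expR (lb - la) by rewrite ela elb expRB.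
rewrite elc ela !expRK !powR_expR.
have -> : ln beta = lb by rewrite elb expRK.
set A := expR ((tau + 1) * _); set B := expR (la - lb); set C := expR (beta^-1 * z).
set D := expR _; set E := expR _; set F := expR _; set H := expR _.
have key : A * (B * C) = D * E * (F * H).
  rewrite -!expRD; congr expR; by field.
have -> : beta^-1 ^+ 2 * Q ^+ 2 * A * (B * C) = beta^-1 ^+ 2 * Q ^+ 2 * (A * (B * C)) by ring.
by rewrite key; move: D E F H {key} => D E F H; field.
Qed.

(** The variable z = beta * ln (x / alpha) is the logit of the log-logistic distribution function,
    whose value at x is [logistic z]. *)
Lemma Jtau_logit (R : realType) (n i : nat) (alpha beta tau : R) :
  0 < alpha -> 0 < beta ->
  Jtau n i alpha tau beta =
  ((powR (beta / alpha) tau * powR (cc R i n) (tau + 1) / beta ^+ 2)%:E *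
  \int[mu]_z ((1 + (i%:R - n.+1%:R * logistic z) * z) ^+ 2 *
   laplace_mom (beta_weight (n.+1%:R * (tau + 1))) 0 (((i%:R * beta - 1) * (tau + 1) + 1) / beta) z)%:E)%E.
Proof.
move=> al0 be0; rewrite /Jtau.
pose G x := fos_integrand n i alpha beta tau (ln (x / alpha)).
transitivity (\int[mu]_(x in `]0%R, +oo[%classic) (G x)%:E)%E.
  apply: eq_integral => x; rewrite inE/= in_itv/= andbT => x0; congr EFin.
  by rewrite derive1_ln_fos// fosE// powR_expR.
have Fi : {homo (fun z => alpha * expR (beta^-1 * z)) : x y / x < y}.
  by move=> x y xy; rewrite ltr_pM2l// ltr_expR ltr_pM2l// invr_gt0.
have lF z : ln (alpha * expR (beta^-1 * z) / alpha) = beta^-1 * z.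
  by rewrite mulrAC divff ?gt_eqF// mul1r expRK.
rewrite -(range_scaled_expR al0 be0) (ge0_integral_subst Fi (is_derive_scaled_expR alpha beta));
  last 3 first.
- by move=> z; apply: cvgM; [exact: cvg_cst|exact: continuous_expRM].
- move=> z; apply: (@continuous_comp _ _ _ (fun x : R => ln (x / alpha)) (fos_integrand n i alpha beta tau)).
    apply: (@continuous_comp _ _ _ (fun x : R => x / alpha) (@ln R)).
      by apply: cvgM; [exact: cvg_id|exact: cvg_cst].
    by apply: continuous_ln; rewrite !(divr_gt0, mulr_gt0)// expR_gt0.
  exact: continuous_fos_integrand.
- by move=> z; rewrite /G mulr_ge0 ?sqr_ge0 ?expR_ge0.
rewrite -ge0_integralZl_EFinR.
- by apply: eq_integral => z _; rewrite /G lF fos_integrand_subst.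
- apply: measurable_funM; last by apply: measurable_laplace_mom; exact: measurable_beta_weight.
  apply: continuous_measurable_fun => z.
  have h : (fun z => 1 + (i%:R - n.+1%:R * logistic z) * z) l @[l --> z] -->
      1 + (i%:R - n.+1%:R * logistic z) * z.
    apply: cvgD; first exact: cvg_cst.
    apply: cvgM; last exact: cvg_id.
    apply: cvgB; first exact: cvg_cst.
    apply: cvgM; first exact: cvg_cst.
    by have := @continuous_logistic R 1 z; under eq_fun do rewrite mul1r.
  by apply: (@continuous_comp _ _ _ (fun z : R => 1 + (i%:R - n.+1%:R * logistic z) * z)
    (fun x : R => x ^+ 2)); [exact: h|exact: exprn_continuous].
- by move=> z; rewrite mulr_ge0 ?sqr_ge0// /laplace_mom expr0 mul1r mulr_ge0 ?expR_ge0 ?powR_ge0.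
- by rewrite !mulr_ge0 ?powR_ge0// invr_ge0 sqr_ge0.
Qed.

(** * Identification of the parameters a and b_k and of the six terms *)

Theorem theorem7 (R : realType) (n i : nat) (alpha beta tau : R) :
  (1 <= n)%N -> (1 <= i)%N -> (i <= n)%N ->
  0 < alpha -> 0 < beta -> 0 <= tau -> i%:R * beta * (tau + 1) > tau ->
  let a := ((n - i + 1)%:R * tau * beta + (n - i + 1)%:R * beta + tau) / beta in
  let b := fun k : nat => (i%:R * tau * beta + (i + k)%:R * beta - tau) / beta in
  let P := powR (beta / alpha) tau * powR (cc R i n) (tau + 1) / beta ^+ 2 in
  let C1 := P * Beta a (b 0%N) in
  let C2 := P * i%:R ^+ 2 * Beta a (b 0%N) *
              (trigamma (b 0%N) + trigamma a + (digamma (b 0%N) - digamma a) ^+ 2) in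
  let C3 := P * (n + 1)%:R ^+ 2 * Beta a (b 2%N) *
              (trigamma (b 2%N) + trigamma a + (digamma (b 2%N) - digamma a) ^+ 2) in
  let C4 := P * (2 * i%:R) * Beta a (b 0%N) * (digamma (b 0%N) - digamma a) in
  let C5 := P * (2 * (n + 1)%:R) * Beta a (b 1%N) * (digamma (b 1%N) - digamma a) in
  let C6 := P * (2 * i%:R * (n + 1)%:R) * Beta a (b 1%N) *
              (trigamma (b 1%N) + trigamma a + (digamma (b 1%N) - digamma a) ^+ 2) in
  Jtau n i alpha tau beta = (C1 + C2 + C3 + C4 - C5 - C6)%:E.
Proof.
move=> _ i_gt0 i_le_n alpha_gt0 beta_gt0 tau_ge0 ht a b P C1 C2 C3 C4 C5 C6.
have beta_neq0 : beta != 0 by rewrite gt_eqF.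
(* The subtraction in [nat] is truncated; i <= n makes it the real one. *)
have nE : (n - i + 1)%:R = n%:R - i%:R + 1 :> R by rewrite natrD natrB.
have b0E : ((i%:R * beta - 1) * (tau + 1) + 1) / beta = b 0%N by rewrite /b addn0; field.
have b1E : b 1%N = b 0%N + 1%:R by rewrite /b addn0 natrD; field.
have b2E : b 2%N = b 0%N + 2%:R by rewrite /b addn0 natrD; field.
(* Here a = (n - i + 1)(tau + 1) + tau/beta and b_0 = i(tau + 1) - tau/beta, so the terms tau/beta
   cancel. *)
have cE : n.+1%:R * (tau + 1) = a + b 0%N by rewrite /a /b nE addn0 -natr1; field.
(* The assumption on i, beta and tau says exactly that the numerator of b_0 is positive. *)
have b_gt0 : 0 < b 0%N.
  rewrite /b addn0 divr_gt0// subr_gt0; apply: lt_le_trans ht _.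
  rewrite le_eqVlt; apply/orP; left; apply/eqP.
  by ring.
have a_gt0 : 0 < a.
  have m_gt0 : 0 < (n - i + 1)%:R :> R by rewrite ltr0n addn1.
  rewrite /a divr_gt0// ltr_wpDr// ltr_wpDl ?mulr_gt0// !mulr_ge0// ltW//.
rewrite Jtau_logit// b0E cE integral_sqr_beta// -EFinM -/P /C1 /C2 /C3 /C4 /C5 /C6 b1E b2E addn1.
congr EFin; clear.
move: (Beta _ (b 0%N)) (Beta _ (b 0%N + 1%:R)) (Beta _ (b 0%N + 2%:R)) => B0 B1 B2.
move: (digamma _) (digamma _) (digamma _) (digamma _) => d0 da d1 d2.
move: (trigamma _) (trigamma _) (trigamma _) (trigamma _) => t0 ta t1 t2.
ring.
Qed.
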